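(* Let $\alpha\in(0,1)$ and let $N\ge1$ be an integer. Then the pairs (gap length, number of gaps of that length) describing the multiset of gaps $\widetilde{\operatorname{Gaps}}_{R_\alpha,N}$ correspond to the height-width parameters $(h,\lambda)$ of the zippered rectangle decomposition of the torus $h_\alpha\cdot\mathbb T^2=\mathbb R^2/h_\alpha\mathbb Z^2$ over any horizontal segment $X$ of length $N$. That is, for every $\ell>0$, the number of gaps of length $\ell$ equals the total width of the rectangles of height $\ell$ (the total length of the part of $X$ on which the first return time of the vertical flow to $X$ equals $\ell$).
   Context: $R_\alpha(t)=t+\alpha\bmod1$ on $[0,1)$. The gaps of the orbit segment $\{R_\alpha^n0\}_{n=0}^{N-1}$ are the open subintervals of $(0,1)$ bounded by consecutive points of the set $\{R_\alpha^n0\mid 0\le n\le N-1\}\cup\{1\}$; $\widetilde{\operatorname{Gaps}}_{R_\alpha,N}$ is the multiset of their lengths. $h_\alpha=\begin{pmatrix}1&0\\-\alpha&1\end{pmatrix}$. In the torus $\mathbb R^2/h_\alpha\mathbb Z^2$, a horizontal segment $X$ of length $N$ is the image of a segment $[x_0,x_0+N)\times\{y_0\}$ (regarded as a subset of the torus, with length measured on the torus). The zippered rectangle decomposition over $X$: the unit speed upward vertical flow has a first return map to $X$; $X$ is divided into finitely many subintervals of lengths $\lambda_i$ (the widths) on each of which the first return time is a constant $h_i$ (the heights). *)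

(* Defs.v *)
From HB Require Import structures.
From mathcomp Require Import all_boot all_order all_algebra.
From mathcomp Require Import finmap multiset.
From mathcomp Require Import all_classical all_reals all_analysis.

Set Implicit Arguments.
Unset Strict Implicit.
Unset Printing Implicit Defensive.

Import Order.TTheory GRing.Theory Num.Theory.
Local Open Scope classical_set_scope.
Local Open Scope ring_scope.

Section Gaps.
Variable R : realType.
Implicit Types (alpha : R) (N : nat).

Definition rotation alpha (t : R) : R := t + alpha - (Num.floor (t + alpha))%:~R.

Definition division_points alpha N : {fset R} :=
  (1 |` [fset iter n (rotation alpha) 0%R | n in iota 0 N])%fset.

(* The gap ]a, b[ is encoded by the pair (a, b) of its endpoints. *)
Definition gaps alpha N : {fset (R * R)} :=
  let P := division_points alpha N in
  [fset g in (P `*` P)%fset |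
     (g.1 < g.2) && all (fun c => ~~ (g.1 < c < g.2)) P]%fset.

Definition gap_lengths alpha N : {mset R}%mset :=
  seq_mset [seq g.2 - g.1 | g <- enum_fset (gaps alpha N)].

End Gaps.

Section Torus.
Variables (R : realType) (alpha : R).

Definition vec (x y : R) : 'cV[R]_2 := \col_i (if i == 0 then x else y).

Definition hmx : 'M[R]_2 :=
  \matrix_(i, j) (if i == j then 1 else if i == 0 then 0 else - alpha).

Definition lattice : {pred 'cV[R]_2} :=
  [pred v | `[< exists u : 'cV[int]_2, v = hmx *m map_mx intr u >]].

Fact lattice_zmod_closed : zmod_closed lattice.
Proof.
split=> [|v w]; rewrite !unfold_in /=.
  by apply/asboolP; exists 0; rewrite map_mx0 mulmx0.
move=> /asboolP[a ->] /asboolP[b ->]; apply/asboolP; exists (a - b).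
by rewrite map_mxB mulmxBr.
Qed.

HB.instance Definition _ :=
  GRing.isZmodClosed.Build 'cV[R]_2 lattice lattice_zmod_closed.

Definition torus : zmodType := Quotient.quot lattice.

Definition torus_pt (x y : R) : torus := \pi_(Quotient.quot lattice)%qT (vec x y).

Definition vflow (t : R) (p : torus) : torus := p + torus_pt 0 t.

Definition hsegment (a L y : R) : set torus :=
  [set torus_pt x y | x in `[a, a + L[].

(* One-dimensional length of a subset [Y] of [hsegment a L y].  When alpha is
   rational, [a, a + L[ may wrap around a closed horizontal leaf and visit a
   point of the torus several times; only the first visit is counted. *)
Definition hlength (a L y : R) (Y : set torus) : \bar R :=
  lebesgue_measure [set x | [/\ x \in `[a, a + L[, Y (torus_pt x y) &
    forall x', a <= x' < x -> torus_pt x' y <> torus_pt x y]].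

Definition first_return (X : set torus) (p : torus) (t : R) : Prop :=
  [/\ 0 < t, X (vflow t p) & forall s, 0 < s < t -> ~ X (vflow s p)].

(* A division of X into k subintervals, the i-th being the injective image of
   [a i, a i + w i) x {y} (so that its length on the torus is its width w i),
   with constant first return time h i. *)
Definition zippered_rectangles (X : set torus) (y : R) (k : nat)
    (a w h : 'I_k -> R) : Prop :=
  [/\ forall i, 0 < w i,
      forall i, {in `[a i, a i + w i[ &, injective (torus_pt^~ y)},
      trivIset setT (fun i => hsegment (a i) (w i) y),
      \bigcup_i hsegment (a i) (w i) y = X &
      forall i p, hsegment (a i) (w i) y p -> first_return X p (h i)].

End Torus.

Arguments hsegment {R} alpha a L y.
Arguments hlength {R} alpha a L y Y.

(* Main.v *)
Require Import Defs.
From HB Require Import structures.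
From mathcomp Require Import all_boot all_order all_algebra.
From mathcomp Require Import finmap multiset.
From mathcomp Require Import all_classical all_reals all_analysis.
From mathcomp Require Import ring lra zify.

Import Order.TTheory GRing.Theory Num.Theory.
Local Open Scope classical_set_scope.
Local Open Scope ring_scope.

Set Implicit Arguments.
Unset Strict Implicit.
Unset Printing Implicit Defensive.

(* Over a point of X in the j-th unit cell [x0 + j, x0 + j + 1[, the vertical
   flow meets X again at the times t > 0 such that the j-th orbit point
   increased by t is an orbit point modulo 1; the first such t is the length of
   the gap that begins at the j-th orbit point. Hence the unit cells, one for
   each distinct orbit point, form a zippered rectangle decomposition of X whose
   heights are the gap lengths. The total width at a given height does not
   depend on the decomposition: up to a bounded error it is 1 / m times the
   number of points of (1 / m) Z x {y} in the rectangles of that height, and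
   this set of points only depends on X. *)

(** * Integer differences and unit cells of a segment *)

Section Integrality.
Variable R : realType.
Implicit Type x : R.

Lemma int_num_small x : x \is a Num.int -> -1 < x < 1 -> x = 0.
Proof.
move=> /intrP[k ->] /andP[k_gt k_lt].
have {k_gt} : (-1)%R < k by rewrite -(ltr_int R) rmorphN1.
have {k_lt} : k < 1 by rewrite -(ltr_int R) rmorph1.
by case: k => [[|k]|[|k]].
Qed.

(** The two sides differ by an integer, and the positions inside the cells force it into (-1, 1). *)
Lemma unit_cells_int (x0 x x' : R) (j j' : nat) :
    x - x' \is a Num.int -> x0 + j%:R <= x < x0 + j%:R + 1 ->
    x0 + j'%:R <= x' < x0 + j'%:R + 1 ->
  x - x' = j%:R - j'%:R.
Proof.
move=> xx' /andP[h1 h2] /andP[h3 h4]; apply/eqP; rewrite -subr_eq0; apply/eqP.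
apply: int_num_small; last lra.
by rewrite rpredB// rpredB// natr_int.
Qed.

Lemma unit_cellP (x0 x : R) (n : nat) :
  reflect (exists2 j, (j < n)%N & x0 + j%:R <= x < x0 + j%:R + 1)
          (x \in `[x0, x0 + n%:R[).
Proof.
rewrite in_itv/=; apply: (iffP andP); last first.
  move=> [j jn /andP[xj jx]].
  have : (j.+1%:R : R) <= n%:R by rewrite ler_nat.
  by rewrite -natr1; have := ler0n R j; split; lra.
move=> [x0x xn]; pose f := `|Num.floor (x - x0)|%N.
have /andP[] : f%:R <= x - x0 < f%:R + 1.
  have := floor_itv (x - x0).
  have : 0 <= Num.floor (x - x0) by rewrite floor_ge0 subr_ge0.
  by rewrite intrD /f natr_absz => /ger0_norm ->.
move: f => j h1 h2; exists j; last by lra.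
by rewrite -(ltr_nat R); lra.
Qed.

End Integrality.

(** * Coordinates and vertical flow on the torus *)

Section TorusPoints.
Variables (R : realType) (alpha : R).
Local Notation pt := (torus_pt alpha).

(** Lattice vectors are (m, n - alpha m) with m, n integers: the first coordinate is m, and adding
    alpha m to the second recovers n. *)
Lemma torus_ptP (x y x' y' : R) :
  pt x y = pt x' y' <->
  x - x' \is a Num.int /\ y - y' + alpha * (x - x') \is a Num.int.
Proof.
have -> : (pt x y = pt x' y') <-> vec x y - vec x' y' \in lattice alpha.
  by rewrite Quotient.idealrBE; exact: (rwP eqP).
rewrite unfold_in /= asboolE.
split=> [[u /matrixP E]|[/intrP[m xE] /intrP[n yE]]].
  have := E 0 0; have := E 1 0; rewrite !mxE !big_ord_recl !big_ord0 !mxE /=.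
  rewrite addr0 mul0r mul1r addr0 mul1r addr0 => Ey Ex.
  rewrite Ex Ey; split; first exact: intr_int.
  by rewrite addrAC mulNr addNr add0r intr_int.
exists (\col_i (if i == 0 then m else n)); apply/matrixP => i j.
rewrite !mxE !big_ord_recl !big_ord0 !mxE /=.
by case: i => [[|[|//]]] i2 /=; rewrite -xE -?yE; ring.
Qed.

Lemma vflow_pt (x y t : R) : vflow t (pt x y) = pt x (y + t).
Proof.
have vecE : vec x (y + t) = vec x y + vec 0 t.
  by apply/matrixP => i j; rewrite !mxE; case: eqP; rewrite ?addr0.
by rewrite /vflow /torus_pt vecE; exact/esym/Quotient.pi_add.
Qed.

Lemma first_return_uniq (X : set (torus alpha)) p t t' :
  first_return X p t -> first_return X p t' -> t = t'.
Proof.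
move=> [t0 Xt ht] [t'0 Xt' ht']; case: (ltgtP t t') => // tt'.
- by case: (ht' t); rewrite ?t0.
- by case: (ht t'); rewrite ?t'0.
Qed.

End TorusPoints.

(** * Orbit points and the gaps they bound *)

Section Gaps.
Variables (R : realType) (alpha : R) (N : nat).
Local Notation u n := (iter n (rotation alpha) 0).
Local Notation P := (division_points alpha N).

Lemma orbit_itv n : 0 <= u n < 1.
Proof.
case: n => [|n] /=; first by rewrite lexx ltr01.
by have := floor_itv (u n + alpha); rewrite /rotation intrD => /andP[]; lra.
Qed.

Lemma orbit_int n : u n - alpha * n%:R \is a Num.int.
Proof.
elim: n => [|n IHn] /=; first by rewrite mulr0 subrr rpred0.
rewrite /rotation -natr1.
have -> : u n + alpha - (Num.floor (u n + alpha))%:~R - alpha * (n%:R + 1) =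
    u n - alpha * n%:R - (Num.floor (u n + alpha))%:~R by ring.
by rewrite rpredB// intr_int.
Qed.

Lemma division_pointP p :
  reflect (p = 1 \/ exists2 j, (j < N)%N & p = u j) (p \in P).
Proof.
rewrite !inE; apply: (iffP orP) => [[/eqP->|/imfsetP[j /=]]|[->|[j jN ->]]].
- by left.
- by rewrite mem_iota => jN ->; right; exists j.
- by left.
- by right; apply/imfsetP; exists j => //=; rewrite mem_iota.
Qed.

Lemma gapP g :
  reflect [/\ g.1 \in P, g.2 \in P, g.1 < g.2 &
              {in P, forall c, ~~ (g.1 < c < g.2)}] (g \in gaps alpha N).
Proof.
rewrite !inE /=.
apply: (iffP and3P) => [[/andP[g1 g2] lt12 /allP]|[g1 g2 lt12 /allP]].
  by split.
by split=> //; apply/andP.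
Qed.

Lemma gap_left g : g \in gaps alpha N ->
  exists2 j, (j < N)%N & g.1 = u j.
Proof.
case/gapP => /division_pointP[g1|//] /division_pointP g2 lt12 _; exfalso.
case: g2 => [g2|[j _ g2]]; move: lt12; rewrite g1 g2 ?ltxx//.
by have := orbit_itv j; lra.
Qed.

Lemma gap_right_le1 g : g \in gaps alpha N -> g.2 <= 1.
Proof.
case/gapP => _ /division_pointP[->//|[j _ ->]] _ _.
by have := orbit_itv j; lra.
Qed.

(** Of two different right ends, the nearer one would lie inside the other gap. *)
Lemma gap_left_inj : {in gaps alpha N &, injective fst}.
Proof.
move=> [p q] [p' q'] /gapP[/= _ qP pq pqP] /gapP[/= _ q'P pq' pq'P] /= pE.
rewrite -{p'}pE in pq' pq'P *; congr pair; case: (ltgtP q q') => // lt.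
- by move: (pq'P _ qP); rewrite pq lt.
- by move: (pqP _ q'P); rewrite pq' lt.
Qed.

(** The right end is the least division point beyond [u j]; the point 1 ensures that there is
    one. *)
Lemma gap_exists j : (j < N)%N -> exists2 g, g \in gaps alpha N & g.1 = u j.
Proof.
move=> jN; have P1 : 1 \in P by apply/division_pointP; left.
pose right_of (c : P) := u j < val c.
have right1 : right_of ([` P1]%fset) by case/andP: (orbit_itv j).
have [q ujq q_min] : exists2 q, right_of q &
    forall c, right_of c -> val q <= val c.
  by case: (arg_minP val right1) => q; exists q.
exists (u j, val q) => //; apply/gapP; split=> //=; last first.
- move=> c cP; apply/negP => /andP[ujc cq].
  by have := q_min [` cP]%fset ujc; rewrite leNgt cq.
- by apply/division_pointP; right; exists j.
Qed.

(* The least index along the orbit of a point that the orbit may visit again,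
   which happens when [alpha] is rational. *)
Definition first_visit (p : R) : nat := index p [seq u n | n <- iota 0 N].

Lemma first_visit_min j : (j < N)%N ->
  u (first_visit (u j)) = u j /\ (first_visit (u j) <= j)%N.
Proof.
move=> jN; set s := [seq u n | n <- iota 0 N].
have sN : size s = N by rewrite size_map size_iota.
have s_nth i : (i < N)%N -> nth 0 s i = u i.
  by move=> iN; rewrite (nth_map 0%N) ?size_iota// nth_iota.
have us : u j \in s by apply: map_f; rewrite mem_iota.
have lt : (first_visit (u j) < N)%N by rewrite -[X in (_ < X)%N]sN index_mem.
split; first by rewrite -s_nth // nth_index.
by rewrite leqNgt; apply/negP => /(before_find 0)/=; rewrite s_nth// eqxx.
Qed.

End Gaps.

(** * The decomposition of X given by the gaps *)

Section GapRectangles.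
Variables (R : realType) (alpha : R) (N : nat) (x0 y0 : R).
Hypothesis N_gt0 : (0 < N)%N.
Local Notation pt := (torus_pt alpha).
Local Notation u n := (iter n (rotation alpha) 0).
Local Notation X := (hsegment alpha x0 N%:R y0).

(** The horizontal difference is j - j', so alpha (j - j') is an integer; hence the orbit points
    agree modulo 1, and both lie in [0, 1). *)
Lemma torus_pt_cells (x x' : R) (j j' : nat) :
    x0 + j%:R <= x < x0 + j%:R + 1 -> x0 + j'%:R <= x' < x0 + j'%:R + 1 ->
  pt x y0 = pt x' y0 -> x - x' = j%:R - j'%:R /\ u j = u j'.
Proof.
move=> xj xj' /torus_ptP[int_xx']; rewrite subrr add0r.
rewrite (unit_cells_int int_xx' xj xj') => int_a; split=> //.
apply/eqP; rewrite -subr_eq0; apply/eqP/int_num_small; last first.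
  by have := orbit_itv alpha j; have := orbit_itv alpha j'; lra.
have -> : u j - u j' =
  u j - alpha * j%:R - (u j' - alpha * j'%:R) + alpha * (j%:R - j'%:R) by ring.
by rewrite rpredD// rpredB// orbit_int.
Qed.

Lemma torus_pt_orbit (x : R) (j j' : nat) :
  u j = u j' -> pt (x - j%:R + j'%:R) y0 = pt x y0.
Proof.
move=> ujj'; apply/torus_ptP.
have -> : x - j%:R + j'%:R - x = j'%:R - j%:R by ring.
split; first by rewrite rpredB// natr_int.
have -> : y0 - y0 + alpha * (j'%:R - j%:R) =
  u j - alpha * j%:R - (u j' - alpha * j'%:R) by rewrite ujj'; ring.
by rewrite rpredB// orbit_int.
Qed.

(** Landing in cell j' means a horizontal translation by j' - j; the vertical condition is then that
    t + alpha (j - j') is an integer. *)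
Lemma vflow_hsegment (x t : R) (j : nat) : x0 + j%:R <= x < x0 + j%:R + 1 ->
  X (vflow t (pt x y0)) <->
  exists2 j', (j' < N)%N & u j + t - u j' \is a Num.int.
Proof.
rewrite vflow_pt => xj.
have shiftE j' : u j + t - u j' =
    u j - alpha * j%:R - (u j' - alpha * j'%:R) + (t + alpha * (j%:R - j'%:R)).
  by ring.
split=> [[x' /unit_cellP[j' j'N xj'] /esym/torus_ptP[int_xx' int_y]]|].
  exists j' => //; move: int_y; rewrite (unit_cells_int int_xx' xj xj').
  rewrite [y0 + t]addrC addrK shiftE => int_t.
  by rewrite rpredD// rpredB// orbit_int.
move=> [j' j'N]; rewrite shiftE => int_t.
have {}int_t : t + alpha * (j%:R - j'%:R) \is a Num.int.
  rewrite -[X in X \is a _]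
    (addKr (u j - alpha * j%:R - (u j' - alpha * j'%:R))).
  by rewrite rpredD// rpredN rpredB// orbit_int.
exists (x - j%:R + j'%:R); first by apply/unit_cellP; exists j' => //; lra.
apply/esym/torus_ptP.
have -> : x - (x - j%:R + j'%:R) = j%:R - j'%:R by ring.
by rewrite [y0 + t]addrC addrK; split=> //; rewrite rpredB// natr_int.
Qed.

(** Before time [g.2 - g.1] the point [u j + s] stays in (0, 1), so congruence with an orbit point
    would be equality and put a division point inside the gap. *)
Lemma gap_first_return (x : R) (j : nat) g : g \in gaps alpha N ->
    g.1 = u j -> x0 + j%:R <= x < x0 + j%:R + 1 ->
  first_return X (pt x y0) (g.2 - g.1).
Proof.
move=> gN g1 xj; have g2_le1 := gap_right_le1 gN.
have [_ g2P g12 g_gap] := gapP _ _ _ gN.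
split; first by rewrite subr_gt0.
  apply/(vflow_hsegment _ xj).
  have -> : u j + (g.2 - g.1) = g.2 by rewrite g1; ring.
  (* A right end 1 is, modulo 1, the orbit point 0 of index 0. *)
  case/division_pointP: g2P => [->|[j' j'N ->]].
    by exists 0%N; rewrite //= subr0 rpred1.
  by exists j'; rewrite // subrr rpred0.
move=> s /andP[s0 sg] /(vflow_hsegment _ xj)[j' j'N].
have uj := orbit_itv alpha j; have uj' := orbit_itv alpha j'.
move=> /int_num_small shift0.
have {}shift0 : u j + s - u j' = 0 by apply: shift0; lra.
have /g_gap/negP[] : u j' \in division_points alpha N.
  by apply/division_pointP; right; exists j'.
by apply/andP; lra.
Qed.

(** Taking the first visit selects one cell per distinct orbit point, and the one that [hlength]
    counts. *)
Definition gap_cell (g : R * R) : R := x0 + (first_visit alpha N g.1)%:R.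

Lemma gap_cellP g : g \in gaps alpha N ->
  exists j, [/\ (j < N)%N, g.1 = u j, gap_cell g = x0 + j%:R &
    forall i, u i = u j -> (j <= i)%N].
Proof.
move=> gN; have [j jN g1] := gap_left gN.
exists (first_visit alpha N g.1); have [uE jle] := first_visit_min alpha jN.
rewrite /gap_cell g1 uE; split=> //; first exact: leq_ltn_trans jN.
move=> i uij; case: (ltnP i N) => [iN|]; last first.
  exact/leq_trans/ltnW/(leq_ltn_trans jle).
by rewrite -uij; case: (first_visit_min alpha iN).
Qed.

Let gap_of (i : 'I_(size (enum_fset (gaps alpha N)))) : R * R :=
  tnth (in_tuple (enum_fset (gaps alpha N))) i.

Lemma gap_ofP i : gap_of i \in gaps alpha N.
Proof. exact: mem_tnth. Qed.

Lemma gap_of_surj g : g \in gaps alpha N -> exists i, gap_of i = g.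
Proof.
move=> gN; have /tnthP[i ->] : g \in in_tuple (enum_fset (gaps alpha N)) by [].
by exists i.
Qed.

Lemma zippered_rectangles_gaps :
  zippered_rectangles X y0 (gap_cell \o gap_of) (fun=> 1)
    (fun i => (gap_of i).2 - (gap_of i).1).
Proof.
split=> [//|i x x'|i i' _ _|| i p].
- have [j [_ _ /= -> _]] := gap_cellP (gap_ofP i).
  rewrite !in_itv/= => xj xj' /(torus_pt_cells xj xj')[xx' _]; lra.
- have [j [_ gj /= -> _]] := gap_cellP (gap_ofP i).
  have [j' [_ gj' /= -> _]] := gap_cellP (gap_ofP i').
  move=> [p [[x]]]; rewrite /= in_itv/= => xj <- [x'].
  rewrite /= in_itv/= => xj' /(torus_pt_cells xj' xj)[_ ujj'].
  have /(gap_left_inj (gap_ofP i) (gap_ofP i')) : (gap_of i).1 = (gap_of i').1.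
    by rewrite gj gj'.
  rewrite /gap_of !(tnth_nth 0)/= => /eqP.
  by rewrite nth_uniq ?fset_uniq// => /eqP/val_inj.
- apply/seteqP; split=> [p [i _ [x]]|p [x /unit_cellP[j jN xj] <-]].
    have [j [jN _ /= -> _]] := gap_cellP (gap_ofP i).
    by rewrite in_itv/= => xj <-; exists x => //; apply/unit_cellP; exists j.
  (* A point of the j-th cell is also represented in the cell of the first visit to [u j]. *)
  have [g gN g1] := gap_exists alpha jN.
  have [j' [j'N gj' gE _]] := gap_cellP gN.
  have [i iE] := gap_of_surj gN.
  exists i => //; exists (x - j%:R + j'%:R).
    by rewrite /= iE gE in_itv/=; lra.
  by apply: torus_pt_orbit; rewrite -g1 -gj'.
- have [j [_ gj /= gE _]] := gap_cellP (gap_ofP i).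
  case=> x; rewrite /= gE in_itv/= => xj <-.
  exact: (gap_first_return (gap_ofP i) gj).
Qed.

Lemma count_gap_lengths (l : R) :
  \sum_(i < size (enum_fset (gaps alpha N)) | (gap_of i).2 - (gap_of i).1 == l)
    (1 : R) = (gap_lengths alpha N l)%:R.
Proof.
rewrite -(big_tnth _ _ _ (fun g => g.2 - g.1 == l) (fun=> 1)).
by rewrite mset_seqE count_map -sum1_count natr_sum.
Qed.

Lemma hlength_first_return (l : R) :
  hlength alpha x0 N%:R y0 [set p | X p /\ first_return X p l]
  = ((gap_lengths alpha N l)%:R)%:E.
Proof.
have [_ _ triv _ ret] := zippered_rectangles_gaps.
rewrite -count_gap_lengths /hlength.
set E := [set x | _].
have -> : E = \big[setU/set0]_(i | (gap_of i).2 - (gap_of i).1 == l)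
    `[gap_cell (gap_of i), gap_cell (gap_of i) + 1[%classic.
  rewrite -bigcup_seq_cond; apply/seteqP; split=> x.
    move=> [/unit_cellP[j jN xj] [_ ret_l] x_first].
    have [g gN g1] := gap_exists alpha jN.
    have [j' [j'N gj' gE j'_min]] := gap_cellP gN.
    have [i iE] := gap_of_surj gN.
    exists i; rewrite /= iE.
      rewrite mem_index_enum; apply/eqP.
      exact: first_return_uniq (gap_first_return gN g1 xj) ret_l.
    have uE : u j = u j' by rewrite -g1 -gj'.
    have : (j' <= j)%N by exact: j'_min.
    rewrite leq_eqVlt => /predU1P[j'j|j'j]; first by rewrite gE j'j in_itv.
    have lt_j'j : (j'%:R : R) < j%:R by rewrite ltr_nat.
    have j'_ge0 := ler0n R j'.
    (* Were j' < j, this translate would be an earlier visit to the same torus point. *)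
    by case: (x_first (x - j%:R + j'%:R) _ (torus_pt_orbit x uE)); lra.
  case=> i /= /andP[_ /eqP li].
  have [j [jN gj gE j_min]] := gap_cellP (gap_ofP i).
  rewrite gE in_itv/= => xj.
  have xN : x \in `[x0, x0 + N%:R[ by apply/unit_cellP; exists j.
  split=> //.
    split; first by exists x.
    by rewrite -li; exact: gap_first_return (gap_ofP i) gj xj.
  move=> x' /andP[x0x' x'x] ptE.
  have /unit_cellP[j' _ xj'] : x' \in `[x0, x0 + N%:R[.
    by move: xN; rewrite !in_itv/=; lra.
  (* Minimality gives j <= j', and x' - x = j' - j then contradicts x' < x. *)
  have [xx' /j_min] := torus_pt_cells xj' xj ptE.
  by rewrite -(ler_nat R); lra.
rewrite measure_bigsetU_ord//; last first.
  (* The intervals are disjoint because their images in the torus are. *)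
  apply/trivIsetP => i i' _ _ /eqP ii'; apply/seteqP; split=> // x [xi xi'].
  have /trivIsetP/(_ i i' I I) := triv.
  move=> /(_ (introN eqP ii'))/seteqP[/(_ (pt x y0))+ _].
  by apply; split; exists x.
rewrite -sumEFin; apply: eq_bigr => i _.
apply: (etrans (lebesgue_measure_itv _)); rewrite /= lte_fin ltrDl ltr01.
by rewrite -EFinB; congr EFin; ring.
Qed.

End GapRectangles.

(** * Counting points of (1 / m) Z in an interval *)

Definition int_range (p q : int) : seq int :=
  [seq p + i%:Z | i <- iota 0 `|q - p|%N].

Lemma mem_int_range (p q z : int) :
  p <= q -> (z \in int_range p q) = (p <= z < q).
Proof.
move=> pq; apply/mapP/idP => [[i]|/andP[pz zq]].
  by rewrite mem_iota => /andP[_ i_lt] ->; move: i i_lt => i; lia.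
by exists `|z - p|%N; rewrite ?mem_iota; lia.
Qed.

Lemma size_int_range (R : pzRingType) (p q : int) :
  p <= q -> (size (int_range p q))%:R = q%:~R - p%:~R :> R.
Proof.
by move=> pq; rewrite size_map size_iota pmulrn gez0_abs ?subr_ge0// intrB.
Qed.

Section GridCount.
Variables (R : realType) (m : nat).
Hypothesis m_gt0 : (0 < m)%N.

(** Ceilings at both ends match the half-open interval: z >= t iff z >= ceil t, and z < t iff z <
    ceil t. *)
Definition grid (a w : R) : seq int :=
  int_range (Num.ceil (m%:R * a)) (Num.ceil (m%:R * (a + w))).

Lemma mem_grid a w (z : int) :
  0 < w -> (z \in grid a w) = (z%:~R / m%:R \in `[a, a + w[).
Proof.
move=> w0; have mR : 0 < m%:R :> R by rewrite ltr0n.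
rewrite in_itv/= ler_pdivlMr// ltr_pdivrMr// ![_ * m%:R]mulrC.
rewrite -ceil_le_int real_ltNge ?num_real// -ceil_le_int -ltNge.
have ceil_le : Num.ceil (m%:R * a) <= Num.ceil (m%:R * (a + w)).
  by apply: le_ceil; rewrite ler_pM2l// lerDl ltW.
by rewrite mem_int_range.
Qed.

Lemma grid_uniq a w : uniq (grid a w).
Proof. by rewrite map_inj_uniq ?iota_uniq// => i j /addrI[]. Qed.

Lemma size_grid a w : 0 < w -> `|(size (grid a w))%:R - m%:R * w| <= 1.
Proof.
move=> w0; have mR : 0 < m%:R :> R by rewrite ltr0n.
have ceil_le : Num.ceil (m%:R * a) <= Num.ceil (m%:R * (a + w)).
  by apply: le_ceil; rewrite ler_pM2l// lerDl ltW.
rewrite size_int_range// mulrDr.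
have := ceil_itv (m%:R * a); have := ceil_itv (m%:R * a + m%:R * w).
by rewrite !intrB ler_norml; lra.
Qed.

End GridCount.

(** If y < x, an m above |c| / (x - y) violates the bound. This removes the bounded counting
    error. *)
Lemma ler_add_frac (R : realType) (x y c : R) :
  (forall m, (0 < m)%N -> m%:R * x <= m%:R * y + c) -> x <= y.
Proof.
move=> xy; rewrite leNgt; apply/negP => yx.
have /archi_boundP : 0 <= `|c| / (x - y) by rewrite divr_ge0 // subr_ge0 ltW.
set m := Num.bound _ => cm; have m_gt0 : (0 < m)%N.
  rewrite lt0n; apply: contraTneq cm => ->.
  by rewrite -leNgt divr_ge0 // subr_ge0 ltW.
move: cm; rewrite ltr_pdivrMr ?subr_gt0// mulrBr.
by have := xy _ m_gt0; have := ler_norm c; lra.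
Qed.

(** * Independence of the total widths from the decomposition *)

Section WidthUniqueness.
Variables (R : realType) (alpha : R) (X : set (torus alpha)) (y : R).

(* Each rectangle of width w carries m w + O(1) of the points z / m, and those
   points belong to rectangles of the same height in both decompositions. *)
Lemma zippered_widths_le k (a w h : 'I_k -> R) k' (a' w' h' : 'I_k' -> R) l :
    zippered_rectangles X y a w h -> zippered_rectangles X y a' w' h' ->
  \sum_(i | h i == l) w i <= \sum_(i | h' i == l) w' i.
Proof.
move=> [w0 inj triv cov ret] [w0' inj' triv' cov' ret'].
(* The error is at most 1 per rectangle, over both decompositions. *)
apply: (@ler_add_frac _ _ _ (k + k')%:R) => m m_gt0.
have mR : (m%:R : R) != 0 by rewrite pnatr_eq0 -lt0n.
pose pts (n : nat) (b v g : 'I_n -> R) : seq (torus alpha) :=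
  [seq torus_pt alpha (z%:~R / m%:R) y |
    i <- [seq i <- index_enum 'I_n | g i == l], z <- grid m (b i) (v i)].
have size_pts (n : nat) (b v g : 'I_n -> R) : (forall i, 0 < v i) ->
    `|(size (pts n b v g))%:R - m%:R * \sum_(i | g i == l) v i| <= n%:R.
  move=> v0; rewrite size_allpairs_dep sumnE big_map big_filter.
  rewrite natr_sum mulr_sumr -sumrB (le_trans (ler_norm_sum _ _ _))//.
  rewrite (le_trans (ler_sum _ (fun i _ => size_grid m_gt0 (b i) (v0 i))))//.
  by rewrite sumr_const ler_nat -[leqRHS](card_ord n) max_card.
have sub_pts : {subset pts k a w h <= pts k' a' w' h'}.
  move=> _ /allpairsPdep[i [z [hi zi ->]]]; set p := torus_pt _ _ _.
  move: hi zi; rewrite mem_filter mem_index_enum andbT mem_grid// => /eqP hi zi.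
  have pi : hsegment alpha (a i) (w i) y p by exists (z%:~R / m%:R).
  have Xp : X p by rewrite -cov; exists i.
  move: (Xp); rewrite -cov' => -[i' _ pi'].
  have hi' : h' i' = l.
    by rewrite -hi; apply: first_return_uniq (ret' _ _ pi') (ret _ _ pi).
  (* The representative in the other decomposition differs from z / m by an integer d, so it is the
     grid point (d m + z) / m. *)
  case: pi' => x' x'i' x'p; have /torus_ptP[/intrP[d dE] _] := x'p.
  have x'E : x' = (d * m + z)%:~R / m%:R.
    by rewrite intrD intrM mulrDl mulfK// -dE subrK.
  apply/allpairsPdep; exists i', (d * m + z).
  rewrite mem_filter mem_index_enum hi' eqxx.
  by rewrite mem_grid// -x'E; split.
(* Rectangle bases are disjoint and injectively embedded, so no torus point is listed twice. *)
have uniq_pts : uniq (pts k a w h).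
  apply: allpairs_uniq_dep => [|i _|].
  - by rewrite filter_uniq ?index_enum_uniq.
  - exact: grid_uniq.
  move=> _ _ /allpairsPdep[i [z [_ zi ->]]] /allpairsPdep[i' [z' [_ zi' ->]]].
  move: zi zi' => /= zi zi' ptE; move: zi zi'; rewrite !mem_grid// => zi zi'.
  have ii' : i = i'.
    apply: (triv i i' I I); exists (torus_pt alpha (z%:~R / m%:R) y).
    by split; [exists (z%:~R / m%:R) | exists (z'%:~R / m%:R)].
  case: _ / ii' zi' => zi'; have := inj _ _ _ zi zi' ptE.
  by move=> /(mulIf (invr_neq0 mR))/intr_inj->.
have := uniq_leq_size uniq_pts sub_pts; rewrite -(ler_nat R) natrD.
have := size_pts k a w h w0; have := size_pts k' a' w' h' w0'.
by rewrite !ler_norml; lra.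
Qed.

End WidthUniqueness.

Unset Implicit Arguments.

Theorem corollary1 (R : realType) (alpha : R) (N : nat) (x0 y0 : R)
    (alpha_gt0 : 0 < alpha) (alpha_lt1 : alpha < 1) (N_ge1 : (1 <= N)%N) :
  let X := hsegment alpha x0 N%:R y0 in
  [/\ exists (k : nat) (a w h : 'I_k -> R),
        zippered_rectangles X y0 a w h,
      forall (k : nat) (a w h : 'I_k -> R), zippered_rectangles X y0 a w h ->
        forall l : R, 0 < l ->
          \sum_(i < k | h i == l) w i = (gap_lengths alpha N l)%:R
    & forall l : R, 0 < l ->
        hlength alpha x0 N%:R y0 [set p | X p /\ first_return X p l]
        = ((gap_lengths alpha N l)%:R)%:E].
Proof.
move=> X; have canonical := zippered_rectangles_gaps alpha x0 y0 N_ge1.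
split; first by do 4 eexists; exact: canonical.
(* The gap count becomes the total width at height [l] in the decomposition by gaps, where every
   width is 1. *)
- move=> k a w h rects l _; rewrite -count_gap_lengths; apply/eqP.
  by rewrite eq_le (zippered_widths_le _ rects canonical)
    (zippered_widths_le _ canonical rects).
- by move=> l _; exact: hlength_first_return.
Qed.
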